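(* Let $(V;\mathfrak f,\mathfrak g)$ be a dual-modular instance and $\vartheta:\mathbb R_{\ge0}\to\mathbb R$ a strictly convex function. An allocation $(x,y)\in\mathcal B^{\ge}_{\mathfrak f}\times\mathcal B^{\le}_{\mathfrak g}$ is a minimizer of $\mathsf D_\vartheta(x\|y)$ over $\mathcal B^{\ge}_{\mathfrak f}\times\mathcal B^{\le}_{\mathfrak g}$ if and only if it is locally maximin. If $\vartheta$ is convex but not necessarily strictly convex, then every locally maximin allocation is a minimizer of $\mathsf D_\vartheta(x\|y)$ over $\mathcal B^{\ge}_{\mathfrak f}\times\mathcal B^{\le}_{\mathfrak g}$.
   Context: $V$ is a finite ground set. A dual-modular instance $(V;\mathfrak f,\mathfrak g)$ consists of $\mathfrak f,\mathfrak g:2^V\to\mathbb R_{\ge0}$ with $\mathfrak f(\emptyset)=\mathfrak g(\emptyset)=0$, $\mathfrak f$ monotone and supermodular, $\mathfrak g$ submodular and strictly monotone ($A\subsetneq B\Rightarrow\mathfrak g(A)<\mathfrak g(B)$), normalized so $\mathfrak f(V)=\mathfrak g(V)=1$. For $x\in\mathbb R^V$, $x(S)=\sum_{u\in S}x_u$. $\mathcal B^{\ge}_{\mathfrak f}=\{x\in\mathbb R^V_{\ge0}:x(V)=\mathfrak f(V),\ x(S)\ge\mathfrak f(S)\ \forall S\}$, $\mathcal B^{\le}_{\mathfrak g}=\{y\in\mathbb R^V_{\ge0}:y(V)=\mathfrak g(V),\ y(S)\le\mathfrak g(S)\ \forall S\}$; an allocation is $(x,y)\in\mathcal B^{\ge}_{\mathfrak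 f}\times\mathcal B^{\le}_{\mathfrak g}$ (all $y_u>0$). The $\vartheta$-divergence is $\mathsf D_\vartheta(x\|y)=\sum_{u\in V}y_u\,\vartheta(x_u/y_u)$. An allocation $(x,y)$ is locally maximin if for every $\rho>0$, $S^{(\rho)}=\{v:x_v/y_v\ge\rho\}$ satisfies $x(S^{(\rho)})=\mathfrak f(S^{(\rho)})$ and $y(S^{(\rho)})=\mathfrak g(S^{(\rho)})$. *)

(* Defs.v *)
From mathcomp Require Import all_boot all_order all_algebra.
From mathcomp Require Import interval_inference boolp classical_sets.
From mathcomp Require Import set_interval reals convex.

Set Implicit Arguments.
Unset Strict Implicit.
Unset Printing Implicit Defensive.

Import Order.TTheory GRing.Theory Num.Theory.

Local Open Scope classical_set_scope.
Local Open Scope ring_scope.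

Definition supermodular (R : realType) (V : finType) (f : {set V} -> R) :=
  forall A B : {set V}, f A + f B <= f (A :|: B) + f (A :&: B).

Definition submodular (R : realType) (V : finType) (g : {set V} -> R) :=
  forall A B : {set V}, g (A :|: B) + g (A :&: B) <= g A + g B.

Record dual_modular (R : realType) (V : finType) (f g : {set V} -> R) : Prop :=
  DualModular {
    dm_f_ge0 : forall A : {set V}, 0 <= f A ;
    dm_g_ge0 : forall A : {set V}, 0 <= g A ;
    dm_f_set0 : f finset.set0 = 0 ;
    dm_g_set0 : g finset.set0 = 0 ;
    dm_f_mono : forall A B : {set V}, A \subset B -> f A <= f B ;
    dm_f_super : supermodular f ;
    dm_g_sub : submodular g ;
    dm_g_strict : forall A B : {set V}, A \proper B -> g A < g B ;
    dm_f_setT : f [set: V]%SET = 1 ;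
    dm_g_setT : g [set: V]%SET = 1
  }.

Definition mass (R : realType) (V : finType) (x : V -> R) (S : {set V}) : R :=
  \sum_(u in S) x u.

Definition base_ge (R : realType) (V : finType) (f : {set V} -> R) :
    set (V -> R) :=
  [set x | [/\ forall u, 0 <= x u,
               mass x [set: V]%SET = f [set: V]%SET &
               forall S : {set V}, f S <= mass x S]].

Definition base_le (R : realType) (V : finType) (g : {set V} -> R) :
    set (V -> R) :=
  [set y | [/\ forall u, 0 <= y u,
               mass y [set: V]%SET = g [set: V]%SET &
               forall S : {set V}, mass y S <= g S]].

Definition allocations (R : realType) (V : finType) (f g : {set V} -> R) :
    set ((V -> R) * (V -> R)) :=
  base_ge f `*` base_le g.

(* Division by zero never matters on [allocations f g]: strict monotonicity of
   g gives y u >= g V - g (V \ u) > 0. *)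
Definition divergence (R : realType) (V : finType) (theta : R -> R)
    (x y : V -> R) : R :=
  \sum_(u : V) y u * theta (x u / y u).

Definition superlevel (R : realType) (V : finType) (x y : V -> R) (rho : R) :
    {set V} :=
  [set v : V | rho <= x v / y v]%SET.

Definition locally_maximin (R : realType) (V : finType) (f g : {set V} -> R)
    (x y : V -> R) : Prop :=
  forall rho : R, 0 < rho ->
    mass x (superlevel x y rho) = f (superlevel x y rho) /\
    mass y (superlevel x y rho) = g (superlevel x y rho).

Definition divergence_minimizer (R : realType) (V : finType) (theta : R -> R)
    (f g : {set V} -> R) (x y : V -> R) : Prop :=
  allocations f g (x, y) /\
  forall x' y' : V -> R, allocations f g (x', y') ->
    divergence theta x y <= divergence theta x' y'.

(* A function on the nonnegative reals is encoded as theta : R -> R whose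
   values at negative arguments are unconstrained and never used. *)
Definition nneg_reals (R : realType) : set R := `[0, +oo[.

(* Strict counterpart of the library's [convex_function], which is stated with
   the same barycentre a <| t |> b, that is t * a + (1 - t) * b. *)
Definition strictly_convex_function (R : realType) (D : set R)
    (theta : R -> R) : Prop :=
  forall t a b : R, D a -> D b -> a != b -> 0 < t < 1 ->
    theta (t * a + (1 - t) * b) < t * theta a + (1 - t) * theta b.

(* Main.v *)
(** A convex [theta] has a supporting line of slope [s] at each ratio
    [rho > 0]; multiplied by [y], it bounds [y * theta (x / y)] from below by
    [c * y + s * x], where [c = theta rho - s * rho].  Along decreasing ratios
    [s] decreases and [c] increases, so Abel summation over the superlevel sets,
    which are tight for a locally maximin allocation, shows that such an
    allocation is a minimizer.

    Conversely, fix an allocation and a superlevel set [S].  If every [u] in [S]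
    and [v] outside [S] are separated by a tight set, then [S] is tight, since
    tight sets form a lattice.  Otherwise one can move a small amount of [x]
    from [u] to [v], or of [y] from [v] to [u], and strict convexity makes this
    decrease the divergence. *)

Require Import Defs.
From mathcomp Require Import all_boot all_order all_algebra.
From mathcomp Require Import interval_inference boolp.
From mathcomp Require Import classical_sets reals convex.
From mathcomp Require Import ring lra.

Set Implicit Arguments.
Unset Strict Implicit.
Unset Printing Implicit Defensive.

Import Order.TTheory GRing.Theory Num.Theory.

Local Open Scope classical_set_scope.
Local Open Scope ring_scope.

(** * Convexity on the half-line: chords, supporting lines, perspectives *)

(** Common consequence of [convex_function] and [strictly_convex_function], with a plain real
    weight, so that both halves of the theorem share one argument. *)
Definition nneg_convex (R : realType) (theta : R -> R) : Prop :=
  forall t a b : R, 0 <= a -> 0 <= b -> 0 < t < 1 ->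
    theta (t * a + (1 - t) * b) <= t * theta a + (1 - t) * theta b.

Definition supports (R : realType) (theta : R -> R) (s r : R) : Prop :=
  forall z, 0 <= z -> theta r + s * (z - r) <= theta z.

Lemma nneg_realsP (R : realType) (a : R) : nneg_reals a <-> 0 <= a.
Proof. by rewrite /nneg_reals /= in_itv /= andbT. Qed.

Lemma nneg_convex_of_convex (R : realType) (theta : R -> R) :
  @convex_function R R^o (@nneg_reals R) theta -> nneg_convex theta.
Proof.
move=> cvx t a b a0 b0 /andP[t0 t1].
have h : (0 <= t <= 1)%R by rewrite !ltW.
have ti : Itv.spec (@Itv.num_sem R) (Itv.Real `[0%Z, 1%Z]) t.
  by rewrite /Itv.spec /= /Itv.num_sem /= num_real in_itv /=.
have := cvx (Itv.mk ti) a b.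
rewrite !inE => /(_ _ _)/=.
by apply; apply/nneg_realsP.
Qed.

Lemma nneg_convex_of_strict (R : realType) (theta : R -> R) :
  strictly_convex_function (@nneg_reals R) theta -> nneg_convex theta.
Proof.
move=> cvx t a b a0 b0 t01; have [->|ab] := eqVneq a b.
  by rewrite -!mulrDl subrKC !mul1r.
by apply/ltW/cvx => //; apply/nneg_realsP.
Qed.

(** [b] is the barycentre of [a] and [c] with weight [(c - b) / (c - a)]. This is monotonicity of
    chord slopes, with denominators cleared. *)
Lemma nneg_convex_chord (R : realType) (theta : R -> R) (a b c : R) :
  nneg_convex theta -> 0 <= a -> a < b -> b < c ->
  (theta b - theta a) * (c - b) <= (theta c - theta b) * (b - a).
Proof.
move=> cvx a0 ab bc; have ca : 0 < c - a by lra.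
have ca' : c - a != 0 by rewrite gt_eqF.
have tP : 0 < (c - b) / (c - a) < 1.
  by apply/andP; split; [apply: divr_gt0 => //; lra|rewrite ltr_pdivrMr // mul1r; lra].
have := cvx _ a c a0 (ltW (le_lt_trans a0 (lt_trans ab bc))) tP.
have -> : (c - b) / (c - a) * a + (1 - (c - b) / (c - a)) * c = b by field.
rewrite -(ler_pM2r ca).
have -> : ((c - b) / (c - a) * theta a + (1 - (c - b) / (c - a)) * theta c)
  * (c - a) = (c - b) * theta a + (b - a) * theta c by field.
by move=> h; nra.
Qed.

(* The slope is the left derivative, which is finite since [r > 0]; at [0] a
   supporting line may fail to exist. *)
Lemma supports_exists (R : realType) (theta : R -> R) (r : R) :
  nneg_convex theta -> 0 < r -> exists s, supports theta s r.
Proof.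
move=> cvx r0.
pose E : set R :=
  (fun z => (theta r - theta z) / (r - z)) @` (fun z => 0 <= z < r).
(* Each chord slope to the right of [r] bounds all those to the left. *)
have ubE w : r < w -> ubound E ((theta w - theta r) / (w - r)).
  move=> rw _ [z /andP[z0 zr] <-].
  rewrite ler_pdivrMr ?subr_gt0 // mulrAC ler_pdivlMr ?subr_gt0 //.
  exact: nneg_convex_chord.
have E0 : E !=set0 by exists ((theta r - theta 0) / (r - 0)), 0; rewrite //= lexx.
have Eub : has_ubound E.
  by exists ((theta (r + 1) - theta r) / (r + 1 - r)); apply: ubE; lra.
exists (sup E) => z z0; have [zr|rz|->] := ltgtP z r; last by lra.
  have : (theta r - theta z) / (r - z) <= sup E.
    by apply: ub_le_sup => //; exists z => //=; rewrite z0.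
  by rewrite ler_pdivrMr ?subr_gt0 //; lra.
have : sup E <= (theta z - theta r) / (z - r) by apply: ge_sup => //; exact: ubE.
by rewrite ler_pdivlMr ?subr_gt0 //; lra.
Qed.

(** If the line met [theta] at [z], strict convexity would put [theta] below it at the midpoint of
    [z] and [r]. *)
Lemma supports_strict (R : realType) (theta : R -> R) (s r z : R) :
  strictly_convex_function (@nneg_reals R) theta ->
  supports theta s r -> 0 <= r -> 0 <= z -> z != r ->
  theta r + s * (z - r) < theta z.
Proof.
move=> cvx supp r0 z0 zr.
have h01 : 0 < (2^-1 : R) < 1 by apply/andP; split; lra.
have := cvx 2^-1 z r (iffRL (nneg_realsP _) z0) (iffRL (nneg_realsP _) r0) zr h01.
have : 0 <= 2^-1 * z + (1 - 2^-1) * r by lra.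
by move=> /supp; lra.
Qed.

(** Evaluate each line at the other's base point and add. *)
Lemma supports_mono (R : realType) (theta : R -> R) (s1 s2 r1 r2 : R) :
  supports theta s1 r1 -> supports theta s2 r2 ->
  0 <= r1 -> 0 <= r2 -> r1 < r2 -> s1 <= s2.
Proof.
move=> h1 h2 r10 r20 r12; have := h1 _ r20; have := h2 _ r10.
move=> k2 k1.
by rewrite -(@ler_pM2r _ (r2 - r1)) ?subr_gt0 //; lra.
Qed.

(** The line at [r2] is evaluated at [r1]. Since [r1] carries no line of its own, it may be [0]. *)
Lemma supports_intercept (R : realType) (theta : R -> R) (s1 s2 r1 r2 : R) :
  s1 <= s2 -> supports theta s2 r2 -> 0 <= r1 ->
  theta r2 - s2 * r2 <= theta r1 - s1 * r1.
Proof. by move=> s12 h2 r10; have := h2 _ r10; nra. Qed.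

Lemma perspective_le (R : realType) (theta : R -> R) (s r x y : R) :
  0 < y -> theta r + s * (x / y - r) <= theta (x / y) ->
  (theta r - s * r) * y + s * x <= y * theta (x / y).
Proof.
move=> y0; rewrite -(ler_pM2l y0); suff -> : y * (theta r + s * (x / y - r)) =
  (theta r - s * r) * y + s * x by [].
by field; rewrite gt_eqF.
Qed.

Lemma perspective_lt (R : realType) (theta : R -> R) (s r x y : R) :
  0 < y -> theta r + s * (x / y - r) < theta (x / y) ->
  (theta r - s * r) * y + s * x < y * theta (x / y).
Proof.
move=> y0; rewrite -(ltr_pM2l y0); suff -> : y * (theta r + s * (x / y - r)) =
  (theta r - s * r) * y + s * x by [].
by field; rewrite gt_eqF.
Qed.

Lemma perspective_eq (R : realType) (theta : R -> R) (s x y : R) :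
  0 < y -> y * theta (x / y) = (theta (x / y) - s * (x / y)) * y + s * x.
Proof. by move=> y0; field; rewrite gt_eqF. Qed.

(** * Abel summation over level sets *)

(* Peel off the least positive value of [w] on its support. *)
Lemma sum_layers_ge0 (R : realType) (V : finType) (w d : V -> R) :
  (forall u, 0 <= w u) ->
  (forall t, 0 < t -> 0 <= \sum_(u | t <= w u) d u) ->
  0 <= \sum_u w u * d u.
Proof.
have [n] := ubnP #|[pred u | 0 < w u]|.
elim: n w => // n IHn w wn w0 wd.
have [u0 u0P|wz] := pickP [pred u | 0 < w u]; last first.
  rewrite big1 // => u _; have := wz u; rewrite /= lt_neqAle w0 andbT.
  by move=> /negbFE/eqP <-; rewrite mul0r.
case: (@arg_minP _ _ _ u0 [pred u | 0 < w u] w u0P) => u1 /= u1P minP.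
pose w' u := if 0 < w u then w u - w u1 else 0.
have suppE u : (w u1 <= w u) = (0 < w u).
  by apply/idP/idP => [/(lt_le_trans u1P)|/minP].
(* The peeled layer has height [w u1] and the support of [w] as its base. *)
have -> : \sum_u w u * d u = \sum_u w' u * d u + w u1 * \sum_(u | w u1 <= w u) d u.
  rewrite mulr_sumr (big_mkcond (fun u => w u1 <= w u)) -big_split /=.
  apply: eq_bigr => u _; rewrite suppE /w'; case: ifP => [_|wu]; first by ring.
  have -> : w u = 0 by apply/eqP; move: wu; rewrite lt_neqAle w0 andbT eq_sym => /negbFE.
  by ring.
apply: addr_ge0; last by rewrite mulr_ge0 ?wd // ltW.
apply: IHn => [|u|t t0].
- rewrite -ltnS; apply: leq_trans wn; rewrite ltnS; apply: proper_card.
  apply/properP; split; last first.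
    by exists u1; rewrite !inE // /w' u1P subrr ltxx.
  by apply/fintype.subsetP => u; rewrite !inE /w'; case: ifP => //; rewrite ltxx.
- by rewrite /w'; case: ifP => // /minP; rewrite subr_ge0.
(* The level set of [w'] at [t] is that of [w] at [t + w u1]. *)
- have /wd : 0 < t + w u1 by rewrite addr_gt0.
  congr (_ <= _); apply: eq_bigl => u; rewrite /w'.
  case: ifP => [_|wu]; first by rewrite lerBrDr.
  apply/idP/idP => [h|]; last by rewrite leNgt t0.
  by move: wu; rewrite (lt_le_trans _ h) // addr_gt0.
Qed.

(** Each nonempty upper level set of [w] is a superlevel set of [r], so the layer decomposition
    applies once [w] is shifted to be nonnegative; the shift is free because [d] sums to zero. *)
Lemma comonotone_sum_ge0 (R : realType) (V : finType) (r w d : V -> R) :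
  (forall u, 0 <= r u) ->
  (forall u v, r u <= r v -> w u <= w v) ->
  \sum_u d u = 0 ->
  (forall rho, 0 < rho -> 0 <= \sum_(u | rho <= r u) d u) ->
  0 <= \sum_u w u * d u.
Proof.
move=> r0 wmono dT drho.
have [u0 _|V0] := pickP (@predT V); last by rewrite big_pred0.
case: (@arg_minP _ _ _ u0 predT w isT) => u1 _ minP.
have -> : \sum_u w u * d u = \sum_u (w u - w u1) * d u.
  under [RHS]eq_bigr do rewrite mulrBl.
  by rewrite sumrB -mulr_sumr dT mulr0 subr0.
apply: sum_layers_ge0 => [u|t t0]; first by rewrite subr_ge0 minP.
have [u2 u2P|Et] := pickP [pred u | t <= w u - w u1]; last by rewrite big_pred0.
case: (@arg_minP _ _ _ u2 [pred u | t <= w u - w u1] r u2P) => u3 /= u3P min3.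
have E u : (t <= w u - w u1) = (r u3 <= r u).
  by apply/idP/idP => [/min3//|/wmono h]; rewrite (le_trans u3P) // lerB.
rewrite (eq_bigl _ _ E).
(* A threshold of [0] escapes the last hypothesis, but then the set is all of [V] and the sum is
   zero. *)
have := r0 u3; rewrite le_eqVlt => /orP[/eqP <-|/drho //].
by rewrite (eq_bigl predT) ?dT // => u; rewrite r0.
Qed.

(** * Locally maximin allocations are minimizers *)

Lemma base_le_gt0 (R : realType) (V : finType) (f g : {set V} -> R) (y : V -> R)
  (u : V) : dual_modular f g -> base_le g y -> 0 < y u.
Proof.
move=> fg [_ yT yg].
have uT : [set~ u]%SET \proper [set: V]%SET.
  by rewrite properT; apply/eqP => /setP/(_ u); rewrite !inE eqxx.
have := le_lt_trans (yg _) (dm_g_strict fg uT); rewrite -yT /mass.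
rewrite [ltRHS](bigD1 u) ?inE //=.
rewrite (eq_bigl (fun w => w != u)) => [|w]; last by rewrite !inE.
by rewrite [X in _ < _ + X](eq_bigl (fun w => w != u)) ?ltrDr // => w; rewrite inE.
Qed.

Lemma mass_setT (R : realType) (V : finType) (x : V -> R) :
  mass x [set: V]%SET = \sum_u x u.
Proof. by apply: eq_bigl => u; rewrite inE. Qed.

Lemma mass_superlevel (R : realType) (V : finType) (x y z : V -> R) (rho : R) :
  mass z (superlevel x y rho) = \sum_(u | rho <= x u / y u) z u.
Proof. by apply: eq_bigl => u; rewrite inE. Qed.

(* [f] has full mass on the positive superlevel set of a locally maximin
   allocation, which forces every [x'] in the base of [f] to vanish off it. *)
Lemma locally_maximin_zero (R : realType) (V : finType) (f g : {set V} -> R)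
    (x y x' : V -> R) (v : V) :
  dual_modular f g -> allocations f g (x, y) -> locally_maximin f g x y ->
  base_ge f x' -> x v = 0 -> x' v = 0.
Proof.
move=> fg [/= xf yg] lm [x'0 x'T x'f] xv.
have y0 w : 0 < y w by exact: base_le_gt0 fg yg.
have [x0 xT _] := xf.
(* The least positive ratio is a threshold whose superlevel set is the support of [x]; this support
   is nonempty because [f] is 1 on [V]. *)
have ex_rho : exists2 rho, 0 < rho & forall u, (rho <= x u / y u) = (0 < x u).
  have [u0 u0P|xz] := pickP [pred u | 0 < x u]; last first.
    have : mass x [set: V]%SET = 0.
      rewrite mass_setT big1 // => u _; apply/eqP; have := xz u.
      by rewrite /= lt_neqAle x0 andbT eq_sym => /negbFE.
    by rewrite xT (dm_f_setT fg) => /eqP; rewrite oner_eq0.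
  case: (@arg_minP _ _ _ u0 [pred u | 0 < x u] (fun u => x u / y u) u0P).
  move=> u1 /= u1P minP; exists (x u1 / y u1); first by rewrite divr_gt0.
  move=> u; apply/idP/idP => [h|/minP//].
  by rewrite -(@pmulr_lgt0 _ (y u)^-1) ?invr_gt0 // (lt_le_trans _ h) ?divr_gt0.
have [rho rho0 rhoE] := ex_rho.
have [xS _] := lm rho rho0.
have : mass x' [set: V]%SET <= mass x' (superlevel x y rho).
  apply: le_trans (x'f _); rewrite x'T -xS -xT mass_setT mass_superlevel.
  rewrite (bigID (fun u => rho <= x u / y u)) /= [X in _ + X]big1 ?addr0 //.
  by move=> u; rewrite rhoE lt_neqAle x0 andbT negbK => /eqP.
rewrite mass_setT mass_superlevel (bigID (fun u => rho <= x u / y u)) /=.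
rewrite gerDl => h; apply/eqP; rewrite eq_le x'0 andbT; apply: le_trans h.
rewrite (bigD1 v) /= ?rhoE ?xv ?ltxx //.
by rewrite lerDl sumr_ge0.
Qed.

Lemma locally_maximin_minimizer (R : realType) (V : finType)
    (f g : {set V} -> R) (theta : R -> R) (x y : V -> R) :
  dual_modular f g -> nneg_convex theta -> allocations f g (x, y) ->
  locally_maximin f g x y -> divergence_minimizer theta f g x y.
Proof.
move=> fg cvx xy lm; split=> // x' y' [/= x'f y'g].
have [/= xf yg] := xy.
have y0 u : 0 < y u by exact: base_le_gt0 fg yg.
have y'0 u : 0 < y' u by exact: base_le_gt0 fg y'g.
have [x0 xT _] := xf; have [x'0 x'T x'S] := x'f.
have [_ yT _] := yg; have [_ y'T y'S] := y'g.
pose r u := x u / y u.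
have r0 u : 0 <= r u by rewrite divr_ge0 // ltW.
have r'0 u : 0 <= x' u / y' u by rewrite divr_ge0 // ltW.
have /choice[s0 s0P] : forall rho, exists s, 0 < rho -> supports theta s rho.
  move=> rho; have [rho0|rho0] := boolP (0 < rho); last by exists 0.
  by have [s ?] := supports_exists cvx rho0; exists s.
(* At [r u = 0] no supporting line need exist, but there [x' u = 0] as well. *)
pose s u := if 0 < r u then s0 (r u) else - \sum_w `|s0 (r w)|.
pose c u := theta (r u) - s u * r u.
have sP u : 0 < r u -> supports theta (s u) (r u).
  by rewrite /s => ru; rewrite ru; exact: s0P.
have rz u : ~~ (0 < r u) -> r u = 0.
  by rewrite lt_neqAle r0 andbT negbK => /eqP.
(* At ratio [0], [s] is minus the sum of the absolute values of the [s0 (r w)], hence below every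
   other slope. *)
have s_mono u v : r u <= r v -> s u <= s v.
  rewrite le_eqVlt => /orP[/eqP ruv|ruv]; first by rewrite /s ruv.
  have rv : 0 < r v by exact: le_lt_trans ruv.
  have [ru|ru] := boolP (0 < r u); first exact: supports_mono (sP _ ru) (sP _ rv) _ _ _.
  rewrite /s rv (negbTE ru) lerNl (le_trans (ler_norm _)) // normrN.
  by rewrite (bigD1 v) //= lerDl sumr_ge0.
have c_anti u v : r u <= r v -> c v <= c u.
  have [rv ruv|/rz rv] := boolP (0 < r v).
    by apply: supports_intercept (sP _ rv) _ => //; exact: s_mono.
  by rewrite /c rv => ru; rewrite (_ : r u = 0) ?mulr0 //; apply/eqP; rewrite eq_le ru r0.
(* At ratio [0] both sides equal [y' u * theta 0], because [x' u] vanishes. *)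
have term u : c u * y' u + s u * x' u <= y' u * theta (x' u / y' u).
  have [ru|/rz ru] := boolP (0 < r u); first exact/perspective_le/(sP _ ru).
  have xu : x u = 0.
    by apply/eqP; move/eqP: ru; rewrite mulf_eq0 invr_eq0 (gt_eqF (y0 u)) orbF.
  rewrite (locally_maximin_zero fg xy lm x'f xu) /c ru !(mulr0, mul0r, addr0, subr0).
  by rewrite mulrC.
(* On a superlevel set, [x'] has mass at least that of [f], which is attained by [x]; dually, [y']
   has mass at most that of [g], attained by [y]. *)
have xge : 0 <= \sum_u s u * (x' u - x u).
  apply: (comonotone_sum_ge0 r0 s_mono); first by rewrite sumrB -!mass_setT xT x'T subrr.
  move=> rho /lm[xS _]; rewrite sumrB -!(mass_superlevel x y) xS.
  by rewrite subr_ge0.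
have yge : 0 <= \sum_u - c u * (y u - y' u).
  apply: (comonotone_sum_ge0 r0); first by move=> u v /c_anti; rewrite lerN2.
    by rewrite sumrB -!mass_setT yT y'T subrr.
  move=> rho /lm[_ yS]; rewrite sumrB -!(mass_superlevel x y) yS.
  by rewrite subr_ge0.
(* For [(x, y)] itself the bound [term] is an equality, so the difference of divergences dominates
   the two sums. *)
rewrite -subr_ge0 (le_trans (addr_ge0 xge yge)) // -big_split -sumrB /=.
apply: ler_sum => u _; have := term u.
rewrite (perspective_eq theta (s u) (x u) (y0 u)) -/(r u) -/(c u).
by lra.
Qed.

(** * Tight sets of a supermodular lower bound, and feasible transfers *)

Definition transfer (R : realType) (V : finType) (z : V -> R) (u v : V) (e : R) :
  V -> R := fun w => z w - e * (w == u)%:R + e * (w == v)%:R.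

Lemma mass_transfer (R : realType) (V : finType) (z : V -> R) (u v : V) (e : R)
    (A : {set V}) :
  mass (transfer z u v e) A = mass z A - e * (u \in A)%:R + e * (v \in A)%:R.
Proof.
have ind a : \sum_(w in A) e * (w == a)%:R = e * (a \in A)%:R.
  rewrite -mulr_sumr; congr (_ * _); have [aA|aA] := boolP (a \in A).
    by rewrite (bigD1 a) //= eqxx big1 ?addr0 // => w /andP[_ /negbTE ->].
  by rewrite big1 // => w wA; case: eqP aA => // <-; rewrite wA.
by rewrite /mass big_split sumrB /= !ind.
Qed.

Section Tight.
Variables (R : realType) (V : finType) (h : {set V} -> R) (z : V -> R).
Hypotheses (h_super : supermodular h) (h_le : forall A, h A <= mass z A).

Lemma mass_modular (A B : {set V}) :
  mass z (A :|: B)%SET + mass z (A :&: B)%SET = mass z A + mass z B.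
Proof.
rewrite /mass !(big_mkcond (fun w => w \in _)) -!big_split /=.
by apply: eq_bigr => w _; rewrite !inE; case: (w \in A); case: (w \in B); rewrite /= ?addr0 ?add0r.
Qed.

(** The slacks at the union and the intersection are nonnegative, and by supermodularity their sum
    is at most zero. *)
Lemma tight_setUI (A B : {set V}) : mass z A = h A -> mass z B = h B ->
  mass z (A :|: B)%SET = h (A :|: B)%SET /\ mass z (A :&: B)%SET = h (A :&: B)%SET.
Proof.
move=> hA hB; have := h_super A B; have := mass_modular A B.
have := h_le (A :|: B)%SET; have := h_le (A :&: B)%SET.
by move=> ? ? ? ?; split; lra.
Qed.

(** For [u] in [S], intersecting the sets that separate [u] from each outside point gives a tight
    set between [u] and [S]; [S] is the union of these. Tightness of the empty set and of [V] covers
    the empty union and intersection. *)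
Lemma tight_separated (S : {set V}) :
  mass z finset.set0 = h finset.set0 -> mass z [set: V]%SET = h [set: V]%SET ->
  (forall u v, u \in S -> v \notin S ->
    exists T : {set V}, [/\ mass z T = h T, u \in T & v \notin T]) ->
  mass z S = h S.
Proof.
move=> h0 hT sep.
have /choice[T TP] : forall u, exists T : {set V}, u \in S ->
    [/\ mass z T = h T, u \in T & T \subset S].
  move=> u; have [uS|uS] := boolP (u \in S); last by exists S.
  have /choice[F FP] : forall v, exists T : {set V}, v \notin S ->
      [/\ mass z T = h T, u \in T & v \notin T].
    by move=> v; have [vS|vS] := boolP (v \in S); [exists S | have [T] := sep u v uS vS; exists T].
  exists (\bigcap_(v | v \notin S) F v)%SET => _; split.
  - by elim/big_ind: _ => // [A B hA hB|v /FP[]//]; have [] := tight_setUI hA hB.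
  - by apply/finset.bigcapP => v /FP[].
  - apply/fintype.subsetP => w /finset.bigcapP wF; apply/negPn/negP => wS.
    by have [_ _ /negP] := FP w wS; apply; exact: wF.
suff -> : S = (\bigcup_(u in S) T u)%SET.
  by elim/big_ind: _ => // [A B hA hB|u /TP[]//]; have [] := tight_setUI hA hB.
apply/eqP; rewrite finset.eqEsubset; apply/andP; split.
  by apply/fintype.subsetP => u uS; apply/finset.bigcupP; exists u => //; have [] := TP u uS.
by apply/finset.bigcupsP => u /TP[].
Qed.

(** Only sets containing [u] but not [v] lose mass. None of them is tight, so their least slack is a
    positive [e0]. *)
Lemma transfer_feasible (u v : V) :
  ~ (exists T : {set V}, [/\ mass z T = h T, u \in T & v \notin T]) ->
  exists2 e0, 0 < e0 & forall e, 0 < e <= e0 ->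
    forall A, h A <= mass (transfer z u v e) A.
Proof.
move=> nsep; pose P := [pred T : {set V} | (u \in T) && (v \notin T)].
have slack T : P T -> 0 < mass z T - h T.
  move=> /andP[uT vT]; rewrite subr_gt0 lt_neqAle h_le andbT.
  by apply/eqP => hT; apply: nsep; exists T.
have [e0 e00 e0P] : exists2 e0, 0 < e0 & forall T, P T -> e0 <= mass z T - h T.
  have [T0 T0P|noT] := pickP P; last by exists 1 => // T; rewrite noT.
  case: (@arg_minP _ _ _ T0 P (fun T => mass z T - h T) T0P) => T1 T1P minP.
  by exists (mass z T1 - h T1) => //; exact: slack.
exists e0 => // e /andP[e_gt0 ee0] A; rewrite mass_transfer.
have := h_le A; have := e0P A; rewrite /P /=.
case: (u \in A); case: (v \in A) => /= h1 h2; lra.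
Qed.

End Tight.

(** * Transfers that decrease the divergence *)

(* The move changes the ratios from [x1/y1 > x2/y2] towards each other without
   crossing; comparing the supporting lines at the new ratios gives the gain. *)
Lemma perspective_exchange (R : realType) (theta : R -> R)
    (x1 y1 x2 y2 p q : R) :
  strictly_convex_function (@nneg_reals R) theta ->
  0 <= x1 -> 0 < y1 -> 0 <= x2 -> 0 < y2 -> 0 <= p -> 0 <= q -> 0 < y2 - q ->
  0 < x1 - p -> (x2 + p) / (y2 - q) <= (x1 - p) / (y1 + q) ->
  x1 / y1 != (x1 - p) / (y1 + q) ->
  (y1 + q) * theta ((x1 - p) / (y1 + q)) + (y2 - q) * theta ((x2 + p) / (y2 - q))
    < y1 * theta (x1 / y1) + y2 * theta (x2 / y2).
Proof.
move=> cvx x10 y10 x20 y20 p0 q0 y2q x1p.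
set r1 := (x1 - p) / _; set r2 := (x2 + p) / _ => r21 neq.
have cvx' := nneg_convex_of_strict cvx.
have y1q : 0 < y1 + q by lra.
have r1_gt0 : 0 < r1 by rewrite divr_gt0.
have [s1 s1P] := supports_exists cvx' r1_gt0.
have h1 : (theta r1 - s1 * r1) * y1 + s1 * x1 < y1 * theta (x1 / y1).
  apply: perspective_lt => //; apply: supports_strict cvx s1P _ _ neq; first exact: ltW.
  by rewrite divr_ge0 // ltW.
have e1 := perspective_eq theta s1 (x1 - p) y1q; rewrite -/r1 in e1.
have r2_ge0 : 0 <= r2 by rewrite divr_ge0 ?(ltW y2q) ?addr_ge0.
(* If [r2] is [0], a supporting line there may fail to exist; but then [x2] and [p] vanish, and the
   line at [r1] evaluated at [0] suffices. *)
move: r2_ge0; rewrite le_eqVlt => /orP[/eqP r2z|r2_gt0].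
  have : x2 + p = 0.
    apply/eqP; move/esym/eqP: r2z.
    by rewrite /r2 mulf_eq0 invr_eq0 (gt_eqF y2q) orbF.
  move=> xp; have x2z : x2 = 0 by lra.
  have pz : p = 0 by lra.
  have := s1P 0 (lexx 0); rewrite -r2z x2z mul0r sub0r.
  move: e1 h1; rewrite pz !subr0; nra.
(* When the new ratios coincide, one line must serve both to ensure [s2 <= s1]. *)
have [s2 s2P s21] : exists2 s2, supports theta s2 r2 & s2 <= s1.
  move: r21; rewrite le_eqVlt => /orP[/eqP ->|r21]; first by exists s1.
  have [s2 s2P] := supports_exists cvx' r2_gt0.
  by exists s2 => //; apply: supports_mono s2P s1P _ _ r21; exact: ltW.
have h2 : (theta r2 - s2 * r2) * y2 + s2 * x2 <= y2 * theta (x2 / y2).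
  by apply/perspective_le/s2P => //; rewrite divr_ge0 // ltW.
have e2 := perspective_eq theta s2 (x2 + p) y2q; rewrite -/r2 in e2.
have c12 := supports_intercept s21 s1P (ltW r2_gt0).
rewrite e1 e2.
(* The gain is at least [p * (s1 - s2) + q * (c2 - c1)]; strictness comes from [h1]. *)
have := mulr_ge0 p0 (_ : 0 <= s1 - s2); rewrite subr_ge0 => /(_ s21).
have := mulr_ge0 q0 (_ : 0 <= (theta r2 - s2 * r2) - (theta r1 - s1 * r1)).
rewrite subr_ge0 => /(_ c12).
set c1 := theta r1 - _ in h1 *; set c2 := theta r2 - _ in h2 *.
by move=> ? ?; lra.
Qed.

Lemma divergence_two (R : realType) (V : finType) (theta : R -> R)
    (x y x' y' : V -> R) (u v : V) :
  u != v -> (forall w, w != u -> w != v -> x' w = x w /\ y' w = y w) ->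
  y' u * theta (x' u / y' u) + y' v * theta (x' v / y' v) <
    y u * theta (x u / y u) + y v * theta (x v / y v) ->
  divergence theta x' y' < divergence theta x y.
Proof.
move=> uv off h.
have split2 (F : V -> R) :
    \sum_w F w = F u + F v + \sum_(w | (w != u) && (w != v)) F w.
  by rewrite (bigD1 u) //= (bigD1 v) 1?eq_sym //= addrA.
rewrite /divergence !split2 -subr_gt0 opprD addrACA -sumrB big1 ?addr0 ?subr_gt0 //.
by move=> w /andP[wu wv]; have [-> ->] := off w wu wv; rewrite subrr.
Qed.

Lemma transfer0 (R : realType) (V : finType) (z : V -> R) (u v : V) :
  transfer z u v 0 = z.
Proof. by apply/funext => w; rewrite /transfer !mul0r subr0 addr0. Qed.

Lemma transfer_src (R : realType) (V : finType) (z : V -> R) (u v : V) (e : R) :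
  u != v -> transfer z u v e u = z u - e.
Proof. by move=> /negbTE uv; rewrite /transfer eqxx uv mulr1 mulr0 addr0. Qed.

Lemma transfer_tgt (R : realType) (V : finType) (z : V -> R) (u v : V) (e : R) :
  u != v -> transfer z u v e v = z v + e.
Proof.
by rewrite eq_sym => /negbTE uv; rewrite /transfer eqxx uv mulr1 mulr0 subr0.
Qed.

Lemma transfer_off (R : realType) (V : finType) (z : V -> R) (u v w : V) (e : R) :
  w != u -> w != v -> transfer z u v e w = z w.
Proof.
by move=> /negbTE wu /negbTE wv; rewrite /transfer wu wv !mulr0 subr0 addr0.
Qed.

Lemma transfer_ge0 (R : realType) (V : finType) (z : V -> R) (u v : V) (e : R) :
  (forall w, 0 <= z w) -> u != v -> 0 <= e <= z u ->
  forall w, 0 <= transfer z u v e w.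
Proof.
move=> z0 uv /andP[e0 ez] w; have [->|wu] := eqVneq w u.
  by rewrite transfer_src // subr_ge0.
have [->|wv] := eqVneq w v; first by rewrite transfer_tgt // addr_ge0.
by rewrite transfer_off.
Qed.

(** Moving [x] from [u] to [v] and [y] from [v] to [u] both lower the ratio at [u] and raise it at
    [v]. The product inequality says that the new ratios do not cross. *)
Lemma transfer_divergence_lt (R : realType) (V : finType) (theta : R -> R)
    (x y : V -> R) (u v : V) (p q : R) :
  strictly_convex_function (@nneg_reals R) theta ->
  (forall w, 0 <= x w) -> (forall w, 0 < y w) -> u != v ->
  0 <= p -> 0 <= q -> 0 < p + q -> p < x u -> q < y v ->
  (x v + p) * (y u + q) <= (x u - p) * (y v - q) ->
  divergence theta (transfer x u v p) (transfer y v u q) < divergence theta x y.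
Proof.
move=> cvx x0 y0 uv p0 q0 pq px qy cross.
have vu : v != u by rewrite eq_sym.
apply: (divergence_two uv) => [w wu wv|]; first by rewrite !transfer_off.
rewrite (transfer_src x _ uv) (transfer_tgt x _ uv).
rewrite (transfer_src y _ vu) (transfer_tgt y _ vu).
have yu := y0 u; have yv := y0 v.
have yuq : 0 < y u + q by lra.
apply: perspective_exchange => //; rewrite ?subr_gt0 //.
  by rewrite ler_pdivrMr ?subr_gt0 // mulrAC ler_pdivlMr.
rewrite gt_eqF // ltr_pdivrMr // mulrAC ltr_pdivlMr //.
have [p_gt0|p_le0] := ltP 0 p.
  have := mulr_gt0 p_gt0 yu; have := mulr_ge0 (x0 u) q0; lra.
have q_gt0 : 0 < q by lra.
have xu : 0 < x u by lra.
have := mulr_gt0 xu q_gt0; have := mulr_ge0 p0 (ltW yu); lra.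
Qed.

(** * Minimizers are locally maximin *)

Lemma mass_opp (R : realType) (V : finType) (z : V -> R) (A : {set V}) :
  mass (fun w => - z w) A = - mass z A.
Proof. by rewrite /mass sumrN. Qed.

Lemma minimizer_locally_maximin (R : realType) (V : finType)
    (f g : {set V} -> R) (theta : R -> R) (x y : V -> R) :
  dual_modular f g -> strictly_convex_function (@nneg_reals R) theta ->
  divergence_minimizer theta f g x y -> locally_maximin f g x y.
Proof.
move=> fg cvx [[/= xf yg] xy_min] rho rho0.
have y0 w : 0 < y w by exact: base_le_gt0 fg yg.
have [x0 xT xS] := xf; have [y0' yT yS] := yg.
have gap u v : u \in superlevel x y rho -> v \notin superlevel x y rho ->
    [/\ u != v, 0 < x u & 0 < x u * y v - x v * y u].
  move=> uS vS; split; first by apply: contraNneq vS => <-.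
    move: uS; rewrite inE => /(lt_le_trans rho0).
    by rewrite pmulr_lgt0 ?invr_gt0.
  move: uS vS; rewrite !inE -ltNge => uS vS; have := lt_le_trans vS uS.
  by rewrite ltr_pdivrMr // mulrAC ltr_pdivlMr // subr_gt0.
split.
- apply: (tight_separated (dm_f_super fg) xS) => [||u v uS vS].
  + by rewrite (dm_f_set0 fg) /mass big_set0.
  + by [].
  have [uv xu k0] := gap u v uS vS; have yu := y0 u; have yv := y0 v.
  apply: contrapT => /(transfer_feasible xS)[e0 e00 e0P].
  (* [e0] keeps the transfer feasible. The other bound is the amount that equalizes the two ratios,
     and it also forces [e < x u]. *)
  pose e := Num.min e0 ((x u * y v - x v * y u) / (y u + y v)).
  have e_gt0 : 0 < e by rewrite lt_min e00 divr_gt0 // addr_gt0.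
  have ee0 : e <= e0 by rewrite ge_min lexx.
  have ek : e * (y u + y v) <= x u * y v - x v * y u.
    by rewrite -ler_pdivlMr ?addr_gt0 // ge_min lexx orbT.
  have ex : e < x u.
    rewrite -(ltr_pM2r yv); have := mulr_gt0 e_gt0 yu.
    have := mulr_ge0 (x0 v) (ltW yu); lra.
  have : divergence theta (transfer x u v e) (transfer y v u 0) < divergence theta x y.
    by apply: transfer_divergence_lt => //; [exact: ltW|rewrite addr0|lra].
  apply/negP; rewrite -leNgt transfer0; apply: xy_min; split=> //=; split.
  + by apply: transfer_ge0 => //; rewrite !ltW.
  + by rewrite mass_transfer !inE xT; lra.
  + by apply: e0P; rewrite e_gt0.
- apply: oppr_inj; rewrite -mass_opp.
  (* Negation turns the submodular upper bound [g] on [y] into a supermodular lower bound on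
     [- y]. *)
  pose h A := - g A; rewrite -/(h _).
  have h_super : supermodular h.
    by move=> A B; have := dm_g_sub fg A B; rewrite /h; lra.
  have h_le A : h A <= mass (fun w => - y w) A by rewrite mass_opp lerN2.
  apply: (tight_separated h_super h_le) => [||u v uS vS].
  + by rewrite /h (dm_g_set0 fg) /mass big_set0 oppr0.
  + by rewrite mass_opp yT.
  have [uv xu k0] := gap u v uS vS; have yu := y0 u; have yv := y0 v.
  apply: contrapT => /(transfer_feasible h_le)[e0 e00 e0P].
  (* As before, with [y v / 2] added to keep [y v - e] positive, since [x v] may be [0]. *)
  pose e := Num.min e0 (Num.min (y v / 2) ((x u * y v - x v * y u) / (x u + x v))).
  have xuv : 0 < x u + x v by rewrite ltr_pwDl.
  have e_gt0 : 0 < e by rewrite !lt_min e00 !divr_gt0.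
  have ee0 : e <= e0 by rewrite ge_min lexx.
  have ey : e <= y v / 2 by rewrite !ge_min lexx orbT.
  have ek : e * (x u + x v) <= x u * y v - x v * y u.
    by rewrite -ler_pdivlMr // !ge_min lexx !orbT.
  have : divergence theta (transfer x u v 0) (transfer y v u e) < divergence theta x y.
    by apply: transfer_divergence_lt => //; [exact: ltW|rewrite add0r|lra|lra].
  apply/negP; rewrite -leNgt transfer0; apply: xy_min; split=> //=; split.
  + by apply: transfer_ge0; [|rewrite eq_sym|apply/andP; split; lra].
  + by rewrite mass_transfer !inE yT; lra.
  (* Moving [- y] from [u] to [v] is moving [y] from [v] to [u]. *)
  + move=> A; have := e0P e _ A; rewrite e_gt0 ee0 => /(_ isT).
    by rewrite !mass_transfer mass_opp /h; lra.
Qed.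

Theorem theorem1p4 (R : realType) (V : finType) (f g : {set V} -> R)
    (fg_dual : dual_modular f g) (theta : R -> R) :
  (strictly_convex_function (@nneg_reals R) theta ->
    forall x y : V -> R, allocations f g (x, y) ->
      (divergence_minimizer theta f g x y <-> locally_maximin f g x y)) /\
  (@convex_function R R^o (@nneg_reals R) theta ->
    forall x y : V -> R, allocations f g (x, y) ->
      locally_maximin f g x y -> divergence_minimizer theta f g x y).
Proof.
split=> cvx x y xy.
- split; first exact: minimizer_locally_maximin.
  exact: locally_maximin_minimizer (nneg_convex_of_strict cvx) xy.
- exact: locally_maximin_minimizer (nneg_convex_of_convex cvx) xy.
Qed.
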